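(* Let $M_1,\ldots,M_n$ be smooth manifolds (each finite-dimensional, or an infinite-dimensional Banach manifold), let $M=M_1\times\cdots\times M_n$, and let $f_1,\ldots,f_n\in C^2(M,\mathbb{R})$ be the players' cost functions, with associated differential game form $\omega$. If $u=(u_1,\ldots,u_n)\in M$ is a differential Nash equilibrium of the game $(f_1,\ldots,f_n)$ and $d\omega(u)$ is non-degenerate, then $u$ is an isolated strict local Nash equilibrium of $(f_1,\ldots,f_n)$.
   Context: Game: there are $n$ players; player $i$ chooses a strategy $u_i\in M_i$ and wants to minimize $f_i$. Each $M_i$ is a second-countable Hausdorff smooth manifold modeled on a Banach space $E_i$ (finite- or infinite-dimensional); $E=E_1\times\cdots\times E_n$. Charts on $M$ are taken to be product charts $(U,\varphi)$ with $U=U_1\times\cdots\times U_n$, $\varphi=\varphi_1\times\cdots\times\varphi_n$, where $(U_i,\varphi_i)$ is a chart on $M_i$. Local Nash equilibrium: $(u_1,\ldots,u_n)\in M$ is a local Nash equilibrium if there exist open sets $W_i\subset M_i$ with $u_i\in W_i$ such that for each $i$, $f_i(u_1,\ldots,u_i,\ldots,u_n)\le f_i(u_1,\ldots,u_i',\ldots,u_n)$ for all $u_i'\in W_i\setminus\{u_i\}$ (only the $i$-th coordinate is changed). It is strict if these inequalities are strict. It is isolated if it has a neighborhood in $M$ containing no other local Nash equilibrium of the game. Partial derivatives: $D_if_j(u)\in T^*_{u_i}M_i$ is the derivative at $u_i$ of the map $\mu_i\mapsto f_j(u_1,\ldots,u_{i-1},\mu_i,u_{i+1},\ldots,u_n)$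 on $M_i$. Differential game form: $\omega=\sum_{i=1}^n\psi_{M_i}\circ df_i:M\to T^*M$, where, under the canonical splitting $T^*_{u}M\cong T^*_{u_1}M_1\oplus\cdots\oplus T^*_{u_n}M_n$, the bundle map $\psi_{M_i}$ sends $(\omega_1,\ldots,\omega_n)$ to $(0,\ldots,0,\omega_i,0,\ldots,0)$. Thus $\omega(u)=(D_1f_1(u),\ldots,D_nf_n(u))$. Differential Nash equilibrium: $u\in M$ is a differential Nash equilibrium if $\omega(u)=0$ and $D_{ii}^2f_i(u)$ is positive-definite for each $i\in\{1,\ldots,n\}$. Here, when $D_if_i(u)=0$, $D_{ii}^2f_i(u)=D_i(D_if_i)(u)$ is the Hessian at the critical point $u_i$ of $\mu_i\mapsto f_i(u_1,\ldots,\mu_i,\ldots,u_n)$, a continuous symmetric bilinear form on $T_{u_i}M_i$, computed in a chart as $D_{ii}^2(f_i\circ\varphi^{-1})(\varphi(u))$. It is called positive-definite if there is $\alpha> 0$ such that, in a chart, $D_{ii}^2(f_i\circ\varphi^{-1})(\varphi(u))(\nu,\nu)\ge\alpha\|\nu\|^2$ for all $\nu\in E_i$ (the existence of such an $\alpha$ does not depend on the chart). The form $d\omega(u)$: $d\omega=\sum_{i=1}^n d(\psi_{M_i}\circ df_i)$ denotes the derivative (not the exterior derivative) of $\omega$. At a point $u$ with $\omega(u)=0$ it is a well-defined continuous bilinear form on $T_uM$: in a product chart put $\omega_\varphi(x)=(D_1(f_1\circ\varphi^{-1})(x),\ldots,D_n(f_n\circ\varphi^{-1})(x))\in E_1^*\times\cdots\times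 E_n^*\cong E^*$; then $d\omega(u)(v,w)=\big(D\omega_\varphi(\varphi(u))v_\varphi\big)(w_\varphi)$, where $v_\varphi,w_\varphi\in E$ represent $v,w$ in the chart. A bounded bilinear form $B$ on a Banach space $F$ is non-degenerate if the linear map $A:F\to F^*$, $A(v)(w)=B(v,w)$, is a linear isomorphism of $F$ onto $F^*$. *)

(* Defs.v *)
From HB Require Import structures.
From mathcomp Require Import all_boot all_order all_algebra.
From mathcomp Require Import all_classical all_reals all_analysis.
Import Order.TTheory GRing.Theory Num.Theory.
Import numFieldNormedType.Exports.

Set Implicit Arguments.
Unset Strict Implicit.
Unset Printing Implicit Defensive.

Local Open Scope classical_set_scope.
Local Open Scope ring_scope.

(* A copy of [forall i, E i] carrying the sup norm, which induces the product
   topology since the family is finite. *)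
Definition normed_prod (R : realType) (n : nat) (E : 'I_n -> normedModType R) :
  Type := forall i, E i.

Section normed_prod_instances.
Context {R : realType} {n : nat} (E : 'I_n -> normedModType R).
Local Notation T := (normed_prod E).
Implicit Types x y z : T.

HB.instance Definition _ := gen_eqMixin T.
HB.instance Definition _ := gen_choiceMixin T.

Let zero : T := fun=> 0.
Let opp x : T := fun i => - x i.
Let add x y : T := fun i => x i + y i.
Let scale (a : R) x : T := fun i => a *: x i.

Let addA : associative add.
Proof. by move=> x y z; apply: functional_extensionality_dep => i; exact: addrA. Qed.
Let addC : commutative add.
Proof. by move=> x y; apply: functional_extensionality_dep => i; exact: addrC. Qed.
Let add0 : left_id zero add.
Proof. by move=> x; apply: functional_extensionality_dep => i; exact: add0r. Qed.
Let addN : left_inverse zero opp add.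
Proof. by move=> x; apply: functional_extensionality_dep => i; exact: addNr. Qed.
HB.instance Definition _ := GRing.isZmodule.Build T addA addC add0 addN.

Let scaleA a b x : scale a (scale b x) = scale (a * b) x.
Proof. by apply: functional_extensionality_dep => i; exact: scalerA. Qed.
Let scale1 : left_id 1 scale.
Proof. by move=> x; apply: functional_extensionality_dep => i; exact: scale1r. Qed.
Let scaleDr : right_distributive scale +%R.
Proof. by move=> a x y; apply: functional_extensionality_dep => i; exact: scalerDr. Qed.
Let scaleDl x : {morph scale^~ x : a b / a + b}.
Proof. by move=> a b; apply: functional_extensionality_dep => i; exact: scalerDl. Qed.
HB.instance Definition _ :=
  GRing.Zmodule_isLmodule.Build R T scaleA scale1 scaleDr scaleDl.

Definition sup_norm x : R := \big[Num.max/0]_(i < n) `|x i|.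

Let norm_ge0 x : 0 <= sup_norm x.
Proof. exact: bigmax_ge_id. Qed.
Let le_norm x i : `|x i| <= sup_norm x.
Proof. exact: (le_bigmax _ (fun i => `|x i|)). Qed.

Let norm_D x y : sup_norm (x + y) <= sup_norm x + sup_norm y.
Proof.
apply: bigmax_le => [|i _]; first by rewrite addr_ge0 ?norm_ge0.
by apply: le_trans (ler_normD _ _) _; rewrite lerD ?le_norm.
Qed.

Let norm_Z (a : R) x : sup_norm (a *: x) = `|a| * sup_norm x.
Proof.
have le b z : sup_norm (b *: z) <= `|b| * sup_norm z.
  apply: bigmax_le => [|i _]; first by rewrite mulr_ge0 ?norm_ge0.
  by rewrite normrZ ler_wpM2l ?le_norm.
apply/eqP; rewrite eq_le le /=; have [->|a0] := eqVneq a 0.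
  by rewrite normr0 mul0r norm_ge0.
rewrite -ler_pdivlMl ?normr_gt0// -normfV.
by rewrite -[in leLHS](scale1r x) -(mulVf a0) -scalerA le.
Qed.

Let norm0_eq0 x : sup_norm x = 0 -> x = 0.
Proof.
move=> x0; apply: functional_extensionality_dep => i.
by apply/eqP; rewrite -normr_le0 -x0 le_norm.
Qed.

HB.instance Definition _ :=
  Lmodule_isNormed.Build R T norm_D norm_Z norm0_eq0.

End normed_prod_instances.

Section bounded_op.
Context {R : realType} (V W : normedModType R).

Definition bounded_op_pred : {pred V -> W} :=
  [pred f : V -> W | `[< linear f /\ continuous f >]].

Let bounded_op_submod : submod_closed bounded_op_pred.
Proof.
split.
  apply/asboolP; split; last by move=> x; exact: cvg_cst.
  by move=> a x y; rewrite /= scaler0 addr0.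
move=> a f g /asboolP[lf cf] /asboolP[lg cg]; apply/asboolP; split.
  move=> b x y; change (a *: f (b *: x + y) + g (b *: x + y) =
    b *: (a *: f x + g x) + (a *: f y + g y)).
  by rewrite lf lg !scalerDr !scalerA (mulrC a) addrACA.
move=> x; apply: (@cvgD _ _ _ _ _ (a *: f) g); last exact: cg.
by apply: cvgZl_tmp; exact: cf.
Qed.
HB.instance Definition _ :=
  GRing.isSubmodClosed.Build R (V -> W) bounded_op_pred bounded_op_submod.

Record bounded_op := BoundedOp {
  bounded_op_fun :> V -> W ;
  bounded_op_funP : bounded_op_fun \in bounded_op_pred }.

HB.instance Definition _ := [isSub for bounded_op_fun].
HB.instance Definition _ := [Choice of bounded_op by <:].
HB.instance Definition _ := [SubChoice_isSubLmodule of bounded_op by <:].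

HB.instance Definition _ (f : bounded_op) :=
  GRing.isLinear.Build R V W *:%R (bounded_op_fun f)
    (asboolW (bounded_op_funP f)).1.

Definition op_norm (f : bounded_op) : R :=
  sup [set `|f x| | x in [set x : V | `|x| <= 1]].

Let op_norm_has_sup (f : bounded_op) :
  has_sup [set `|f x| | x in [set x : V | `|x| <= 1]].
Proof.
split; first by exists `|f 0|, 0 => //=; rewrite normr0 ler01.
have := (asboolW (bounded_op_funP f)).2.
move=> /(@linear_bounded_continuous _ _ _ (f : {linear V -> W})).
move=> /linear_boundedP/pinfty_ex_gt0[M M0 fM].
exists M => _ [x /= x1 <-]; apply: le_trans (fM x) _.
by rewrite ler_piMr// ltW.
Qed.

Let op_norm_ub (f : bounded_op) x : `|x| <= 1 -> `|f x| <= op_norm f.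
Proof.
by move=> x1; apply: ub_le_sup; [exact: (op_norm_has_sup f).2|exists x].
Qed.

Let op_norm_le (f : bounded_op) c :
  (forall x, `|x| <= 1 -> `|f x| <= c) -> op_norm f <= c.
Proof.
move=> fc; apply: ge_sup; first exact: (op_norm_has_sup f).1.
by move=> _ [x /= x1 <-]; exact: fc.
Qed.

Let op_norm_ge0 (f : bounded_op) : 0 <= op_norm f.
Proof. by apply: le_trans (op_norm_ub f (x := 0) _); rewrite ?normr0. Qed.

Let op_norm_D (f g : bounded_op) : op_norm (f + g) <= op_norm f + op_norm g.
Proof.
apply: op_norm_le => x x1; apply: le_trans (ler_normD (f x) (g x)) _.
by rewrite lerD ?op_norm_ub.
Qed.

Let op_norm_Z (a : R) (f : bounded_op) : op_norm (a *: f) = `|a| * op_norm f.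
Proof.
have le b g : op_norm (b *: g) <= `|b| * op_norm g.
  apply: op_norm_le => x x1; rewrite [leLHS](normrZ b (g x)).
  by rewrite ler_wpM2l ?op_norm_ub.
apply/eqP; rewrite eq_le le /=; have [->|a0] := eqVneq a 0.
  by rewrite normr0 mul0r op_norm_ge0.
rewrite -ler_pdivlMl ?normr_gt0// -normfV.
by rewrite -[in leLHS](scale1r f) -(mulVf a0) -scalerA le.
Qed.

Let op_norm0_eq0 (f : bounded_op) : op_norm f = 0 -> f = 0.
Proof.
move=> f0; apply: val_inj; apply/funext => x /=.
have [->|x0] := eqVneq x 0; first exact: (linear0 (f : {linear V -> W})).
have : `|f (`|x|^-1 *: x)| <= 0.
  by rewrite -f0 op_norm_ub// normrZ normfV normr_id mulVf ?normr_eq0.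
rewrite normr_le0 linearZ/= scaler_eq0.
by rewrite invr_eq0 normr_eq0 (negbTE x0) => /eqP.
Qed.

HB.instance Definition _ :=
  Lmodule_isNormed.Build R bounded_op op_norm_D op_norm_Z op_norm0_eq0.

End bounded_op.

(* The Banach-space notion: the induced map [v |-> B v _] is a linear
   isomorphism of [F] onto its topological dual. *)
Definition nondegenerate (R : realType) (F : normedModType R)
    (B : F -> F -> R) : Prop :=
  exists A : {linear F -> bounded_op F R^o},
    (forall v w, A v w = B v w) /\ bijective A.

(* [0] where the library differential ['d f x] is not continuous; this never
   happens when [f] is differentiable at [x]. *)
Definition frechet (R : realType) (V W : normedModType R) (f : V -> W) (x : V) :
  bounded_op V W := insubd 0 ('d f x : V -> W).

Fixpoint Ck (R : realType) (V : normedModType R) (k : nat)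
    (W : normedModType R) (U : set V) (f : V -> W) {struct k} : Prop :=
  match k with
  | 0 => {in U, continuous f}
  | k'.+1 => {in U, forall x, differentiable f x} /\ Ck k' U (frechet f)
  end.

Definition smooth (R : realType) (V W : normedModType R) (U : set V)
  (f : V -> W) : Prop := forall k, Ck k U f.

(* [chart_fun] and [chart_inv] are total functions; their values are
   meaningful on [chart_dom] and on its image, respectively. *)
Record chart (R : realType) (M : topologicalType) (E : normedModType R) :=
  Chart {
    chart_fun :> M -> E ;
    chart_inv : E -> M ;
    chart_dom : set M ;
    chart_dom_open : open chart_dom ;
    chart_cod_open : open (chart_fun @` chart_dom) ;
    chart_funK : {in chart_dom, cancel chart_fun chart_inv} ;
    chart_fun_continuous : {in chart_dom, continuous chart_fun} ;
    chart_inv_continuous : {in chart_fun @` chart_dom, continuous chart_inv} }.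

Definition chart_cod (R : realType) (M : topologicalType)
  (E : normedModType R) (c : chart M E) : set E := c @` chart_dom c.

Definition compatible (R : realType) (M : topologicalType)
    (E : normedModType R) (c d : chart M E) : Prop :=
  smooth (c @` (chart_dom c `&` chart_dom d)) (d \o chart_inv c) /\
  smooth (d @` (chart_dom c `&` chart_dom d)) (c \o chart_inv d).

(* The smooth structure is a maximal atlas. *)
Record banach_manifold (R : realType) (E : completeNormedModType R) :=
  BanachManifold {
    carrier :> topologicalType ;
    carrier_hausdorff : hausdorff_space carrier ;
    carrier_second_countable : @second_countable carrier ;
    atlas : set (chart carrier E) ;
    atlas_cover : forall x, exists2 c, atlas c & chart_dom c x ;
    atlas_compatible : forall c d, atlas c -> atlas d -> compatible c d ;
    atlas_maximal : forall c, (forall d, atlas d -> compatible c d) -> atlas c }.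

(* [dfwith u i v] is [u] with its [i]-th coordinate replaced by [v]. *)
Section local_nash.
Context {R : realType} {n : nat} {M : 'I_n -> topologicalType}.
Implicit Types (f : 'I_n -> prod_topology M -> R) (u : prod_topology M).

Definition local_nash f u : Prop :=
  exists W : forall i, set (M i),
    (forall i, open (W i) /\ W i (u i)) /\
    forall i (v : M i), W i v -> v <> u i -> f i u <= f i (dfwith u i v).

Definition strict_local_nash f u : Prop :=
  exists W : forall i, set (M i),
    (forall i, open (W i) /\ W i (u i)) /\
    forall i (v : M i), W i v -> v <> u i -> f i u < f i (dfwith u i v).

(* [nbhs u V] refers to the product topology on the strategy space. *)
Definition isolated_local_nash f u : Prop :=
  local_nash f u /\
  exists2 V : set (prod_topology M), nbhs u V &
    forall v, V v -> local_nash f v -> v = u.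

End local_nash.

Section differential_nash.
Context {R : realType} {n : nat} {E : 'I_n -> completeNormedModType R}.
Variable M : forall i, banach_manifold (E i).

Local Notation prodM := (prod_topology (fun i => carrier (M i))).
Local Notation prodE := (normed_prod (fun i => E i : normedModType R)).

Definition product_chart := forall i, chart (M i) (E i).

Implicit Types (phi : product_chart) (u : prodM) (f : 'I_n -> prodM -> R).

Definition is_product_chart phi : Prop := forall i, atlas (phi i).

Definition product_chart_at phi u : Prop :=
  is_product_chart phi /\ forall i, chart_dom (phi i) (u i).

Definition product_chart_fun phi u : prodE := fun i => phi i (u i).

Definition product_chart_cod phi : set prodE :=
  [set x | forall i, chart_cod (phi i) (x i)].

Definition in_chart phi (g : prodM -> R) : prodE -> R^o :=
  fun x => g (fun i => chart_inv (phi i) (x i)).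

Definition C2 (g : prodM -> R) : Prop :=
  forall phi, is_product_chart phi ->
    Ck 2 (product_chart_cod phi) (in_chart phi g).

Definition partial (W : normedModType R) (i : 'I_n) (g : prodE -> W) (x : prodE) :
  bounded_op (E i) W :=
  frechet (fun y : E i => g (dfwith x i y)) (x i).

(* The local representative x |-> (D_1 (f_1 o phi^-1) x, ...,
   D_n (f_n o phi^-1) x) of the differential game form. *)
Definition game_form phi f (x : prodE) :
  normed_prod (fun i => bounded_op (E i) R^o) :=
  fun i => partial i (in_chart phi (f i)) x.

(* Intrinsic, as a form on the tangent space, only where the [i]-th component of
   the game form vanishes. *)
Definition hessian phi f (i : 'I_n) (x : prodE) : E i -> E i -> R :=
  fun v w => partial i (partial i (in_chart phi (f i))) x v w.
Arguments hessian phi f i x v w : clear implicits.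

(* The derivative of the local representative of the game form; the pairing
   identifies E_1^* x ... x E_n^* with the dual of E_1 x ... x E_n. *)
Definition d_game_form phi f (x : prodE) : prodE -> prodE -> R :=
  fun v w => \sum_(i < n) frechet (game_form phi f) x v i (w i).

Definition positive_definite (F : normedModType R) (B : F -> F -> R) : Prop :=
  exists2 a : R, 0 < a & forall v, a * `|v| ^+ 2 <= B v v.

(* Vanishing of the game form, positive-definiteness of the Hessians at its
   zeros and nondegeneracy of its derivative there do not depend on the product
   chart around [u]; it is enough to check them in one. *)
Definition differential_nash f u : Prop :=
  exists phi, [/\ product_chart_at phi u,
    game_form phi f (product_chart_fun phi u) = 0 &
    forall i, positive_definite (hessian phi f i (product_chart_fun phi u))].

Definition nondegenerate_d_game_form f u : Prop :=
  exists2 phi, product_chart_at phi u &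
    nondegenerate (d_game_form phi f (product_chart_fun phi u)).

End differential_nash.

(* Main.v *)
From HB Require Import structures.
Require Import Defs.
From mathcomp Require Import all_boot all_order all_algebra.
From mathcomp Require Import all_classical all_reals all_analysis.
From mathcomp Require Import ring.
Import Order.TTheory GRing.Theory Num.Theory.
Import numFieldNormedType.Exports.

(** Two local facts about the game are combined.

    First, freezing the strategies of the other players turns the cost of
    player [i] into a function of one variable in the Banach space [E i].  At a
    differential Nash equilibrium its first derivative vanishes and its second
    derivative is bounded below by a positive multiple of the squared norm, so
    the mean value theorem along segments ([second_order_strict_min]) makes the
    equilibrium a strict local minimum for each player.  This is
    [differential_nash_strict].

    Secondly, at every local Nash equilibrium each of these one-variable
    functions has a local minimum, so the game form vanishes there
    ([local_nash_game_form0], by Fermat's rule [local_min_frechet0]).  It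
    therefore suffices that [u] is an isolated zero of the game form.  The
    derivative [D] of the game form at [u] satisfies [c * `|v| <= `|D v|] for
    some [c > 0]: nondegeneracy says that the operator from the strategy model
    to its dual that corresponds to [D] is bijective, and since both spaces are
    complete the open mapping theorem bounds its inverse
    ([open_mapping], [nondegenerate_lower_bound]).  A map whose derivative at
    a zero is bounded below has no other zero nearby ([isolated_zero]).

    The Hessians and the derivative of the game form may be given in different
    charts around [u].  The first fact is proved in the chart of the Hessians;
    its conclusion, that [u] is a local Nash equilibrium, does not mention
    charts, and it makes the game form vanish at [u] in the other chart, where
    the second fact is proved. *)

Set Implicit Arguments.
Unset Strict Implicit.
Unset Printing Implicit Defensive.

Local Open Scope classical_set_scope.
Local Open Scope ring_scope.

(** * Bounded operators *)

Section bounded_op_theory.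
Context {R : realType} {V W : normedModType R}.
Implicit Types (f : bounded_op V W).

Lemma bounded_op_linear f : linear f.
Proof. exact: (asboolW (bounded_op_funP f)).1. Qed.

Lemma bounded_op_continuous f : continuous f.
Proof. exact: (asboolW (bounded_op_funP f)).2. Qed.

Lemma bounded_op_ext (f g : bounded_op V W) : f =1 g -> f = g.
Proof. by move=> fg; apply: val_inj; apply/funext. Qed.

Lemma op_norm_bound f x : `|f x| <= `|f| * `|x|.
Proof.
have [->|x0] := eqVneq x 0; first by rewrite linear0 !normr0 mulr0.
have nx0 : 0 < `|x| by rewrite normr_gt0.
rewrite -ler_pdivrMr// mulrC -[X in X * _]gtr0_norm ?invr_gt0//.
rewrite -normrZ -linearZ.
have [k k0 fk] := linear_lipschitz (@bounded_op_continuous f).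
apply: ub_le_sup.
  exists k => _ [y /= y1 <-]; apply: le_trans (fk y) _.
  by rewrite ler_piMr// ltW.
exists (`|x|^-1 *: x) => //=.
by rewrite normrZ normfV normr_id mulVf ?normr_eq0.
Qed.

Lemma op_norm_le f c : 0 <= c -> (forall x, `|f x| <= c * `|x|) -> `|f| <= c.
Proof.
move=> c0 fc; apply: ge_sup.
  by exists `|f 0|, 0 => //=; rewrite normr0 ler01.
move=> _ [x /= x1 <-]; apply: le_trans (fc x) _.
by rewrite ler_piMr.
Qed.

Lemma bounded_op_predP (f : V -> W) c :
  linear f -> (forall x, `|f x| <= c * `|x|) -> f \in @bounded_op_pred R V W.
Proof.
move=> lf fc; apply/asboolP; split => //.
pose F : {linear V -> W} := HB.pack f (GRing.isLinear.Build _ _ _ _ f lf).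
apply/(@linear_bounded_continuous _ _ _ F)/linear_boundedP.
exists c; split; first exact: num_real.
by move=> r /ltW cr x; apply: le_trans (fc x) _; rewrite ler_wpM2r.
Qed.

Definition op_of_bound (f : V -> W) c (lf : linear f)
    (fc : forall x, `|f x| <= c * `|x|) : bounded_op V W :=
  BoundedOp (bounded_op_predP lf fc).

End bounded_op_theory.

Section composition.
Context {R : realType}.

Lemma bounded_op_comp_linear (U V W : normedModType R) (T : bounded_op V W)
  (S : bounded_op U V) : linear (T \o S).
Proof. by move=> a u v; rewrite /= !linearP. Qed.

Lemma bounded_op_comp_bound (U V W : normedModType R) (T : bounded_op V W)
  (S : bounded_op U V) u : `|(T \o S) u| <= `|T| * `|S| * `|u|.
Proof.
apply: le_trans (op_norm_bound _ _) _.
by rewrite -mulrA ler_wpM2l ?op_norm_bound.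
Qed.

Definition op_comp (U V W : normedModType R) (T : bounded_op V W)
  (S : bounded_op U V) : bounded_op U W :=
  op_of_bound (bounded_op_comp_linear T S) (bounded_op_comp_bound T S).

Lemma precomp_linear (U V W : normedModType R) (S : bounded_op U V) :
  linear (fun T : bounded_op V W => op_comp T S).
Proof. by move=> a f g; apply: bounded_op_ext. Qed.

Lemma precomp_bound (U V W : normedModType R) (S : bounded_op U V)
  (T : bounded_op V W) : `|op_comp T S| <= `|S| * `|T|.
Proof.
rewrite mulrC; apply: op_norm_le; first by rewrite mulr_ge0.
exact: bounded_op_comp_bound.
Qed.

Definition precomp (U V W : normedModType R) (S : bounded_op U V) :
  bounded_op (bounded_op V W) (bounded_op U W) :=
  op_of_bound (@precomp_linear U V W S) (@precomp_bound U V W S).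

End composition.

(** * Derivatives as first-order estimates *)

Lemma frechetE (R : realType) (V W : normedModType R) (f : V -> W) x :
  differentiable f x -> frechet f x = 'd f x :> (V -> W).
Proof.
move=> df; rewrite /frechet /insubd insubT //.
by apply/asboolP; split; [exact: linearP|exact: diff_continuous].
Qed.

Section has_frechet.
Context {R : realType} {V W : normedModType R}.
Implicit Types (f : V -> W) (x : V) (L : bounded_op V W).

(** Unlike [frechet], which is chosen among all linear maps and has a default
    value, this relation exhibits the derivative and so can be transported
    through compositions by plain estimates. *)
Definition has_frechet f x L :=
  forall e : R, 0 < e ->
    \forall h \near (0 : V), `|f (x + h) - f x - L h| <= e * `|h|.

Lemma differentiable_has_frechet f x :
  differentiable f x -> has_frechet f x (frechet f x).
Proof.
move=> df e e0.
have dE := frechetE df.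
have := diff_locallyxC df; set k := 'o _ => fE.
have : \forall h \near (0 : V), `|k h| <= e * `|h|.
  move: e e0; exact: (littleoP [littleo of k]).
apply: filterS => h.
by rewrite fE dE -addrA -opprD [f x + _ + _]addrC addrK.
Qed.

Lemma has_frechetP f x L : has_frechet f x L ->
  differentiable f x /\ frechet f x = L.
Proof.
move=> fL.
have cL := @bounded_op_continuous _ _ _ L.
have key : f \o shift x = cst (f x) + L +o_ (0 : V) id.
  apply/eqaddoP => e e0; near=> h.
  have -> : (f \o shift x - (cst (f x) + L)) h = f (x + h) - f x - L h.
    by rewrite !fctE /= [h + x]addrC opprD addrA.
  by near: h; exact: fL.
have dL : 'd f x = L :> (V -> W) by apply: diff_unique.
have df : differentiable f x.
  by apply/diff_locallyP; rewrite dL; split.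
split => //; apply: bounded_op_ext => v.
rewrite /frechet /insubd insubT /= ?dL//.
exact: bounded_op_funP.
Unshelve. all: by end_near. Qed.

Lemma has_frechet_near f g x L :
  (\forall y \near x, f y = g y) -> has_frechet g x L -> has_frechet f x L.
Proof.
move=> fg gL e e0.
have fg0 : f x = g x by exact: (nbhs_singleton fg).
have {}fg : \forall h \near (0 : V), f (x + h) = g (x + h).
  by move: fg => /nbhs0P.
near=> h; rewrite fg0 (near fg h) //; near: h; exact: gL.
Unshelve. all: by end_near. Qed.

End has_frechet.

Lemma has_frechet_op_comp (R : realType) (U V W : normedModType R)
    (T : bounded_op V W) (f : U -> V) x L :
  has_frechet f x L -> has_frechet (T \o f) x (op_comp T L).
Proof.
move=> fL e e0.
(* Adding 1 keeps the divisor nonzero when [T] vanishes. *)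
have T1 : 0 < `|T| + 1 by rewrite ltr_wpDl.
have := fL _ (divr_gt0 e0 T1); apply: filterS => h fh /=.
rewrite -!linearB; apply: le_trans (op_norm_bound _ _) _.
apply: le_trans (ler_wpM2l (normr_ge0 _) fh) _.
rewrite mulrA ler_wpM2r// mulrCA ler_piMr ?ltW//.
by rewrite ltr_pdivrMr// mul1r ltrDl.
Qed.

(** * Finite products of normed spaces *)

Section dfwith.
Context {I : eqType} {T : I -> Type}.
Implicit Types (x : forall i, T i).

Lemma dfwith_id x i : dfwith x i (x i) = x.
Proof.
apply: functional_extensionality_dep => j.
have [<-|ij] := eqVneq i j; first by rewrite !dfwithin.
by rewrite !dfwithout.
Qed.

Lemma dfwith_dfwith x i (y z : T i) : dfwith (dfwith x i y) i z = dfwith x i z.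
Proof.
apply: functional_extensionality_dep => j.
have [<-|ij] := eqVneq i j; first by rewrite !dfwithin.
by rewrite !dfwithout.
Qed.

End dfwith.

Section product.
Context {R : realType} {n : nat} {E : 'I_n -> normedModType R}.
Implicit Types x y : normed_prod E.

Lemma normed_prod_norm_le x (c : R) :
  0 <= c -> (forall i, `|x i| <= c) -> `|x| <= c.
Proof. by move=> c0 xc; apply: bigmax_le. Qed.

Lemma normed_prod_norm_lt x (c : R) :
  0 < c -> (forall i, `|x i| < c) -> `|x| < c.
Proof. by move=> c0 xc; apply: bigmax_lt. Qed.

Lemma normed_prod_coord_le x i : `|x i| <= `|x|.
Proof. exact: (le_bigmax _ (fun i => `|x i|)). Qed.

Lemma coord_continuous i : continuous (fun x : normed_prod E => x i).
Proof.
have lin : linear (fun x : normed_prod E => x i) by [].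
have bound (x : normed_prod E) : `|x i| <= 1 * `|x|.
  by rewrite mul1r normed_prod_coord_le.
exact: bounded_op_continuous (op_of_bound lin bound).
Qed.

Lemma box_open (P : forall i, set (E i)) : (forall i, open (P i)) ->
  open [set x : normed_prod E | forall i, P i (x i)].
Proof.
move=> Po; rewrite openE => x Px.
apply: (@filter_forall _ _ (fun i (y : normed_prod E) => P i (y i)) (nbhs x)).
by move=> i; apply: coord_continuous; apply: open_nbhs_nbhs; split.
Qed.

Lemma inclusion_linear i :
  linear (dfwith (0 : normed_prod E) i : E i -> normed_prod E).
Proof.
move=> a u v; apply: functional_extensionality_dep => j /=.
change (dfwith (0 : normed_prod E) i (a *: u + v) j =
  a *: dfwith (0 : normed_prod E) i u j + dfwith (0 : normed_prod E) i v j).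
have [<-|ij] := eqVneq i j; first by rewrite !dfwithin.
by rewrite !dfwithout// ?scaler0 ?addr0.
Qed.

Lemma inclusion_bound i (v : E i) :
  `|dfwith (0 : normed_prod E) i v : normed_prod E| <= 1 * `|v|.
Proof.
rewrite mul1r; apply: normed_prod_norm_le => // j.
have [<-|ij] := eqVneq i j; first by rewrite !dfwithin.
by rewrite !dfwithout// ?normr0.
Qed.

Definition inclusion i : bounded_op (E i) (normed_prod E) :=
  op_of_bound (@inclusion_linear i) (@inclusion_bound i).

Lemma dfwithD x i (y h : E i) :
  dfwith x i (y + h) = (dfwith x i y : normed_prod E) + inclusion i h
  :> normed_prod E.
Proof.
apply: functional_extensionality_dep => j.
change (dfwith x i (y + h) j =
  dfwith x i y j + dfwith (0 : normed_prod E) i h j).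
have [<-|ij] := eqVneq i j; first by rewrite !dfwithin.
by rewrite !dfwithout// ?addr0.
Qed.

(** The chain rule for the affine isometry [dfwith x i], whose linear part is
    the inclusion of the [i]-th factor by [dfwithD]. *)
Lemma has_frechet_slice (W : normedModType R) (g : normed_prod E -> W) x i
    (y : E i) L :
  has_frechet g (dfwith x i y) L ->
  has_frechet (fun z => g (dfwith x i z)) y (op_comp L (inclusion i)).
Proof.
move=> gL e e0.
have i0 : inclusion i h @[h --> (0 : E i)] --> (0 : normed_prod E).
  rewrite -[X in _ --> X](linear0 (inclusion i)).
  exact: bounded_op_continuous.
have gi : \forall h \near (0 : E i),
    `|g ((dfwith x i y : normed_prod E) + inclusion i h) - g (dfwith x i y)
      - L (inclusion i h)| <= e * `|inclusion i h|.
  exact: i0 _ (gL _ e0).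
move: gi; apply: filterS => h gh.
rewrite dfwithD; apply: (le_trans gh).
apply: (ler_wpM2l (ltW e0)); rewrite -[leRHS]mul1r; exact: inclusion_bound.
Qed.

Lemma dfwith_cvg x i (y : E i) :
  (dfwith x i z : normed_prod E) @[z --> y] --> (dfwith x i y : normed_prod E).
Proof.
apply/cvgrPdist_le => e e0; near=> z.
rewrite -[z](subrKC y) dfwithD opprD addrA subrr add0r normrN.
apply: le_trans (inclusion_bound _) _; rewrite mul1r distrC.
by near: z; apply: cvgr_dist_le.
Unshelve. all: by end_near. Qed.

End product.

Section tuple.
Context {R : realType} {n : nat}.
Context {V : normedModType R} {E : 'I_n -> normedModType R}.
Implicit Types L : normed_prod (fun i => bounded_op V (E i)).

Lemma tuple_linear L :
  linear ((fun v i => L i v) : V -> normed_prod E).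
Proof.
move=> a u v; apply: functional_extensionality_dep => i.
exact: bounded_op_linear.
Qed.

Lemma tuple_bound L v : `|(fun i => L i v) : normed_prod E| <= `|L| * `|v|.
Proof.
apply: normed_prod_norm_le => [|i]; first by rewrite mulr_ge0.
apply: le_trans (op_norm_bound _ _) _; rewrite ler_wpM2r//.
exact: (@normed_prod_coord_le _ _ (fun i => bounded_op V (E i))).
Qed.

Definition op_tuple L : bounded_op V (normed_prod E) :=
  op_of_bound (@tuple_linear L) (@tuple_bound L).

Lemma has_frechet_tuple (f : forall i, V -> E i) L x :
  (forall i, has_frechet (f i) x (L i)) ->
  has_frechet ((fun y i => f i y) : V -> normed_prod E) x (op_tuple L).
Proof.
move=> fL e e0.
have : \forall h \near (0 : V), forall i,
    `|f i (x + h) - f i x - L i h| <= e * `|h|.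
  by apply: filter_forall => i; exact: fL.
apply: filterS => h fh; apply: normed_prod_norm_le => [|i]; last exact: fh.
by rewrite mulr_ge0// ltW.
Qed.

End tuple.

(** * Interior minima *)

Section minimum.
Context {R : realType} {V : normedModType R}.
Implicit Types (h : V -> R^o) (x : V).

(** Fermat's rule: where [L v < 0], a short step along [v] would decrease [h],
    because the error of the linear approximation is at most half the gain. *)
Lemma local_min_frechet0 h x L : has_frechet h x L ->
  (\forall y \near x, h x <= h y) -> L = 0.
Proof.
move=> hL hmin; apply: bounded_op_ext => v.
change (L v = 0 :> R).
wlog Lv : v / L v < 0.
  move=> H; have [Lv|Lv|//] := ltgtP (L v) 0; first exact: H.
  apply/eqP; rewrite -oppr_eq0 -[- _](linearN L); apply/eqP/H.
  by rewrite [L _](linearN L) oppr_lt0.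
exfalso.
(* With this [e] the error [e * `|t *: v|] stays below half of [t * - L v]. *)
pose e := - L v / (`|v| + 1) / 2.
have v1 : 0 < `|v| + 1 by rewrite ltr_wpDl.
have e0 : 0 < e by rewrite !divr_gt0// oppr_gt0.
have tv0 : (t *: v : V) @[t --> (0 : R)^'+] --> (0 : V).
  rewrite -[X in _ --> X](scale0r v); apply: cvgZr_tmp.
  exact: cvg_at_right_filter cvg_id.
have H1 := tv0 _ (hL _ e0).
move: hmin => /nbhs0P /tv0 H2.
near (0 : R)^'+ => t.
have t0 : 0 < t by near: t; exact: nbhs_right_gt.
have /= A1 : `|h (x + t *: v) - h x - L (t *: v)| <= e * `|t *: v|.
  by near: t; exact: H1.
have /= A2 : h x <= h (x + t *: v) by near: t; exact: H2.
have : - L (t *: v) <= e * `|t *: v|.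
  apply: le_trans _ A1; apply: le_trans _ (ler_norm _).
  by rewrite lerDr subr_ge0.
rewrite linearZ normrZ gtr0_norm// => A3.
have {}A3 : t * (- L v) <= t * (e * `|v|) by rewrite mulrN mulrCA.
rewrite ler_pM2l// in A3.
have : e * `|v| <= e * (`|v| + 1).
  by apply: (ler_wpM2l (ltW e0)); rewrite lerDl.
rewrite /e [X in _ <= X]mulrAC divfK ?gt_eqF// => A4.
have := le_trans A3 A4; apply/negP; rewrite -ltNge.
by rewrite ltr_pdivrMr// mulr_natr mulr2n ltrDl oppr_gt0.
Unshelve. all: by end_near. Qed.

(** By the mean value theorem [h (x + v) - h x] is the derivative of [h] in
    the direction [v] at some [x + c *: v] with [0 < c < 1].  Since the
    derivative vanishes at [x], this number is [c * H v v], which is at least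
    [c * a * `|v| ^+ 2], up to an error of at most half that bound when [v] is
    small. *)
Lemma second_order_strict_min h x
    (H : bounded_op V (bounded_op V R^o)) (a : R) :
  (\forall y \near x, differentiable h y) ->
  frechet h x = 0 -> has_frechet (frechet h) x H ->
  0 < a -> (forall v, a * `|v| ^+ 2 <= H v v) ->
  \forall y \near x, y <> x -> h x < h y.
Proof.
move=> dh h0 hH a0 Ha.
have a20 : 0 < a / 2 by rewrite divr_gt0.
have [r /= r0 hr] :=
  iffLR nbhs_norm0P (filterI (iffLR (nbhs0P _ _) dh) (hH _ a20)).
apply/nbhs0P; apply: (iffRL nbhs_norm0P); exists r => //= v /= vr xv.
have v0 : v != 0 by apply/eqP => v0; apply: xv; rewrite v0 addr0.
have small (t : R) : t \in `[0, 1]%R -> `|t *: v| < r.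
  rewrite in_itv/= => /andP[t0 t1]; rewrite normrZ ger0_norm//.
  by apply: le_lt_trans vr; rewrite ler_piMl.
pose phi (t : R) : R := h (x + t *: v).
have dphi (t : R) : t \in `[0, 1]%R ->
    is_derive t 1 phi (frechet h (x + t *: v) v).
  move=> /small/hr[dht _]; rewrite frechetE// -deriveE//.
  (* Both derivatives are limits of the same difference quotient. *)
  have E : (fun s : R => s^-1 *: ((phi \o shift t) (s *: 1) - phi t)) =
    (fun s : R =>
      s^-1 *: ((h \o shift (x + t *: v)) (s *: v) - h (x + t *: v))).
    apply/funext => s; rewrite /phi /=; congr (_ *: (h _ - _)).
    by rewrite scalerDl [s *: 1]mulr1 addrCA.
  have dhv : derivable h (x + t *: v) v by exact: diff_derivable.
  by split; rewrite /derivable /derive E.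
have cphi : {within `[0, 1], continuous phi}.
  by apply: derivable_within_continuous => t /dphi[].
have dphi' (t : R) : t \in `]0, 1[%R ->
    is_derive t 1 phi (frechet h (x + t *: v) v).
  by move=> /subset_itv_oo_cc; exact: dphi.
have [c c01] := MVT ltr01 dphi' cphi.
rewrite /phi scale1r scale0r addr0 subr0 mulr1 => hE.
rewrite -subr_gt0 hE.
have [c0 c1] : 0 < c /\ c < 1 by move: c01; rewrite in_itv/= => /andP.
have [_] := hr _ (small _ (subset_itv_oo_cc c01)).
rewrite /= h0 subr0 => close.
have := le_trans (op_norm_bound _ v) (ler_wpM2r (normr_ge0 v) close).
change (`|(frechet h (x + c *: v) v : R) - H (c *: v) v| <=
  a / 2 * `|c *: v| * `|v| -> 0 < frechet h (x + c *: v) v).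
have -> : H (c *: v) = c *: H v by exact: linearZ.
rewrite normrZ gtr0_norm//.
change (`|(frechet h (x + c *: v) v : R) - c * H v v| <=
  a / 2 * (c * `|v|) * `|v| -> 0 < frechet h (x + c *: v) v).
rewrite distrC => /(le_trans (ler_norm _)).
rewrite lerBlDr -lerBlDl; apply: lt_le_trans.
have -> : a / 2 * (c * `|v|) * `|v| = c * (a * `|v| ^+ 2 / 2) by field.
rewrite -mulrBr mulr_gt0// subr_gt0; apply: lt_le_trans (Ha v).
by rewrite ltr_pdivrMr// ltr_pMr ?ltr1n// mulr_gt0// exprn_gt0// normr_gt0.
Qed.

End minimum.

(** * Completeness of duals and of finite products *)

Section completeness.
Context {R : realType}.

Lemma cauchy_norm (V : normedModType R) (F : set_system V) : ProperFilter F ->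
  cauchy F <-> forall e : R, 0 < e ->
    \forall x \near F, \forall y \near F, `|x - y| <= e.
Proof.
move=> FF; split=> [/cauchy_ballP Fc e e0|Fc].
  have Fc' : \forall x \near F, \forall y \near F, ball x e y.
    exact: nearP_dep (Fc _ e0).
  apply: filterS Fc' => x; apply: filterS => y.
  by rewrite -ball_normE /= => /ltW.
apply/cauchyP => e e0.
have e20 : 0 < e / 2 by rewrite divr_gt0.
have [x Fx] := filter_ex (Fc _ e20).
exists x; move: Fx; apply: filterS => y xy; rewrite -ball_normE /=.
by apply: le_lt_trans xy _; rewrite ltr_pdivrMr// ltr_pMr// ltr1n.
Qed.

(** The limit operator is the pointwise limit; the Cauchy estimate is uniform
    on bounded sets, so it survives the passage to that limit and gives both
    the boundedness of the limit and the convergence in norm. *)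
Lemma bounded_op_complete (V : normedModType R) (W : completeNormedModType R)
  (F : set_system (bounded_op V W)) : ProperFilter F -> cauchy F -> cvg F.
Proof.
move=> FF /cauchy_norm Fc.
have cvl v : cvg ((fun f : bounded_op V W => f v) @ F).
  apply/cauchy_cvgP/cauchy_norm => e e0.
  have v1 : 0 < `|v| + 1 by rewrite ltr_wpDl.
  have := Fc _ (divr_gt0 e0 v1); apply: filterS => f; apply: filterS => g fg.
  apply: (le_trans (op_norm_bound (f - g) v)).
  apply: le_trans (ler_wpM2r (normr_ge0 v) fg) _.
  by rewrite mulrAC ler_pdivrMr// ler_pM2l// lerDl.
pose l v := lim ((fun f : bounded_op V W => f v) @ F).
have key e : 0 < e ->
    \forall f \near F, forall v, `|l v - (f : bounded_op V W) v| <= e * `|v|.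
  move=> e0; have := Fc _ e0; apply: filterS => f fF v.
  apply/ler_addgt0Pl => d d0.
  near F => g.
  have gl : `|l v - g v| <= d by near: g; apply: cvgr_dist_le => //; exact: cvl.
  have fg : `|f - g| <= e by near: g.
  apply: le_trans (ler_distD (g v) _ _) _; apply: lerD gl _.
  rewrite distrC; apply: le_trans (op_norm_bound (f - g) v) _.
  by rewrite ler_wpM2r.
have ll : linear l.
  move=> a u v; apply: (cvg_unique (@norm_hausdorff _ W) (cvl _)).
  rewrite (_ : (fun f => _) = (fun f : bounded_op V W => a *: f u + f v)).
    by apply: cvgD; [apply: cvgZl_tmp; exact: cvl|exact: cvl].
  by apply/funext => f; exact: bounded_op_linear.
have [f0 f0l] := filter_ex (key _ ltr01).
have lb v : `|l v| <= (1 + `|f0|) * `|v|.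
  rewrite -[l v](subrK (f0 v)) mulrDl; apply: le_trans (ler_normD _ _) _.
  by apply: lerD (f0l v) (op_norm_bound _ _).
apply/cvg_ex; exists (op_of_bound ll lb); apply/cvgrPdist_le => e e0.
have := key _ e0; apply: filterS => f fl.
by apply: op_norm_le => [|v]; [exact: ltW|exact: fl].
Unshelve. all: by end_near. Qed.

Lemma normed_prod_complete (n : nat) (E : 'I_n -> completeNormedModType R)
  (F : set_system (normed_prod (fun i => E i : normedModType R))) :
  ProperFilter F -> cauchy F -> cvg F.
Proof.
move=> FF /cauchy_norm Fc.
set T := normed_prod _ in F FF Fc *.
have cvl i : cvg ((fun x : T => x i) @ F).
  apply/cauchy_cvgP/cauchy_norm => e e0.
  have := Fc _ e0; apply: filterS => x; apply: filterS => y xy.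
  exact: le_trans (normed_prod_coord_le (x - y) i) xy.
pose l : T := fun i => lim ((fun x : T => x i) @ F).
apply/cvg_ex; exists l; apply/cvgrPdist_le => e e0.
have : \forall x \near F, forall i, `|l i - x i| <= e.
  by apply: filter_forall => i; apply: cvgr_dist_le => //; exact: cvl.
apply: filterS => x xl; apply: normed_prod_norm_le => //; exact: ltW.
Qed.

End completeness.

(** * The open mapping theorem *)

Section bounded_inverse.
Context {R : realType}.

(** By surjectivity the images of the balls of integer radius cover [W], so
    Baire's theorem provides one whose closure has an interior point [y0].
    Subtracting approximate preimages of [y0] and [y0 + y] yields one of [y]
    when [`|y| < r]; scaling then reaches every [y]. *)
Lemma approximate_preimage (V : normedModType R) (W : completeNormedModType R)
    (A : {linear V -> W}) : (forall y, exists x, A x = y) ->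
  exists2 K : R, 0 <= K &
    forall y, exists x, `|y - A x| <= `|y| / 2 /\ `|x| <= K * `|y|.
Proof.
move=> surjA.
pose S (n : nat) := [set y | exists2 x, `|x| <= n%:R & A x = y].
pose C n := ~` closure (S n).
have [n [y0 [r r0 ballS]]] : exists n y0, exists2 r : R, 0 < r &
    forall y, `|y0 - y| < r -> closure (S n) y.
  apply: contrapT => noball.
  have CD i : open (C i) /\ dense (C i).
    split; first by rewrite openC; exact: closed_closure.
    apply: contrapT => /denseNE[D [[x]]].
    move=> /open_nbhs_nbhs/nbhs_ballP[r /= r0 rD] DC.
    apply: noball; exists i, x, r => // y xy; apply: contrapT => ySi.
    have : (D `&` C i) y by split => //; apply: rD; rewrite -ball_normE.
    by rewrite DC.
  have [] := Baire CD (ex_intro _ 0 I : [set: W] !=set0) openT.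
  move=> y [_ yC]; have [x xy] := surjA y.
  apply: (yC (Num.truncn `|x|).+1 I); apply: subset_closure; exists x => //.
  by apply/ltW; rewrite truncnS_gt.
(* Two errors of size [r / 8] add up to half the norm [r / 2] to which [y] is
   scaled below. *)
have e0 : 0 < r / 8 by rewrite divr_gt0.
have near_S y : `|y0 - y| < r -> exists2 x, `|x| <= n%:R & `|y - A x| < r / 8.
  move=> /ballS/(_ _ (nbhsx_ballx y _ e0))[_ [[x xn <-]]].
  by rewrite -ball_normE => yx; exists x.
have [|x0 x0n x0y] := near_S y0; first by rewrite subrr normr0.
exists (4 * n%:R / r).
  by apply: divr_ge0 (ltW r0); apply: mulr_ge0.
move=> y; have [->|yN0] := eqVneq y 0.
  by exists 0; rewrite linear0 subr0 !normr0 mul0r mulr0.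
have ny0 : 0 < `|y| by rewrite normr_gt0.
pose t := r / 2 / `|y|.
have t0 : 0 < t by rewrite !divr_gt0.
have tV : t^-1 = 2 * `|y| / r by rewrite /t !invf_div; field; rewrite !gt_eqF.
have [|x xn xy] := near_S (y0 + t *: y).
  rewrite opprD addrA subrr add0r normrN normrZ gtr0_norm// divfK ?gt_eqF//.
  by rewrite ltr_pdivrMr// ltr_pMr// ltr1n.
exists (t^-1 *: (x - x0)); split.
  have -> : A (t^-1 *: (x - x0)) = t^-1 *: A (x - x0) by exact: linearZ.
  rewrite -[y in leLHS](scalerK (lt0r_neq0 t0)) -scalerBr normrZ.
  have close : `|t *: y - A (x - x0)| <= r / 8 + r / 8.
    have -> : t *: y - A (x - x0) = (y0 + t *: y - A x) - (y0 - A x0).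
      rewrite linearB !opprB [y0 + _]addrC -!addrA; congr (_ + _).
      by rewrite [RHS]addrC addrA subrK addrC.
    by apply: le_trans (ler_normB _ _) _; apply: lerD; exact: ltW.
  rewrite gtr0_norm ?invr_gt0//.
  apply: le_trans (ler_wpM2l _ close) _; first by rewrite ltW ?invr_gt0.
  by rewrite tV [leLHS](_ : _ = `|y| / 2)//; field; rewrite gt_eqF.
rewrite normrZ gtr0_norm ?invr_gt0// tV.
have xx : `|x - x0| <= n%:R + n%:R.
  by apply: le_trans (ler_normB _ _) _; exact: lerD.
apply: le_trans (ler_wpM2l _ xx) _.
  by rewrite divr_ge0 ?mulr_ge0// ltW.
by rewrite [leLHS](_ : _ = 4 * n%:R / r * `|y|)//; field; rewrite gt_eqF.
Qed.

(** Successive approximation: replacing [y] by the remainder of its approximate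
    preimage halves its norm, so the approximate preimages of the successive
    remainders form a series dominated by a geometric one.  Completeness of [V]
    gives its sum, which is an exact preimage of [y] by continuity of [A]. *)
Lemma open_mapping (V W : completeNormedModType R) (A : {linear V -> W}) :
  continuous A -> (forall y, exists x, A x = y) ->
  exists2 K : R, 0 <= K & forall y, exists2 x, A x = y & `|x| <= K * `|y|.
Proof.
move=> cA surjA; have [K K0 /choice[g gP]] := approximate_preimage surjA.
exists (K * 2) => [|y]; first by rewrite mulr_ge0.
pose r k := iter k (fun z => z - A (g z)) y.
have r_le k : `|r k| <= `|y| * 2^-1 ^+ k.
  elim: k => [|k IH]; first by rewrite expr0 mulr1.
  rewrite exprSr mulrA; apply: le_trans (gP (r k)).1 _.
  by rewrite ler_pM2r.
pose x_ k := g (r k).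
have x_le k : `|x_ k| <= geometric (K * `|y|) 2^-1 k.
  by apply: le_trans (gP (r k)).2 _; rewrite /= -mulrA; exact: ler_wpM2l.
have h1 : `|2^-1 : R| < 1 by rewrite ger0_norm// invf_lt1// ltr1n.
have cgeo := @cvg_geometric_series R (K * `|y|) _ h1.
have nx : cvgn [normed series x_].
  apply: (series_le_cvg _ _ x_le) => //.
  - by move=> k; rewrite /= mulr_ge0 ?mulr_ge0 ?exprn_ge0.
  - by apply/cvg_ex; eexists; exact: cgeo.
have cx := normed_cvg nx.
have As k : A (series x_ k) = y - r k.
  elim: k => [|k IH]; first by rewrite /series /= big_geq// linear0 subrr.
  rewrite seriesSr linearD IH [r k.+1]iterS -/(r k) opprB -addrA; congr (y + _).
  by rewrite addrC.
exists (limn (series x_)).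
  have h1' : A (series x_ k) @[k --> \oo] --> A (limn (series x_)).
    exact: (continuous_cvg _ (cA _) cx).
  have r0 : r @ \oo --> (0 : W).
    apply/norm_cvg0P/(@squeeze_cvgr _ _ _ _ (cst 0) (geometric `|y| 2^-1)).
    - by apply: nearW => k; rewrite normr_ge0 r_le.
    - exact: cvg_cst.
    - exact: cvg_geometric.
  have yr : (y - r k) @[k --> \oo] --> y.
    by rewrite -[X in _ --> X]subr0; apply: cvgB => //; exact: cvg_cst.
  apply: (cvg_unique (@norm_hausdorff _ W) h1').
  by rewrite (funext As).
apply: le_trans (lim_series_norm nx) _.
have -> : K * 2 * `|y| = limn (series (geometric (K * `|y|) 2^-1)).
  by rewrite (cvg_lim _ cgeo)//; field.
apply: (ler_lim nx); first by apply/cvg_ex; eexists; exact: cgeo.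
by apply: nearW => k; apply: ler_sum => i _; exact: x_le.
Qed.

End bounded_inverse.

(** * Isolated zeros and nondegenerate forms *)

Section isolation.
Context {R : realType}.

(** If both [x] and [x + h] are zeros of [G], then [D h] is the error of the
    first-order approximation, hence at most [c / 2 * `|h|]; the lower bound on
    [D] leaves only [h = 0]. *)
Lemma isolated_zero (V W : normedModType R) (G : V -> W) x D (c : R) :
  has_frechet G x D -> 0 < c -> (forall v, c * `|v| <= `|D v|) -> G x = 0 ->
  \forall y \near x, G y = 0 -> y = x.
Proof.
move=> GD c0 Dc G0; have c20 : 0 < c / 2 by rewrite divr_gt0.
apply/nbhs0P; apply: filterS (GD _ c20) => h /=.
rewrite G0 subr0 => + Gh; rewrite Gh sub0r normrN => /(le_trans (Dc h)).
have [->|h0] := eqVneq h 0; first by rewrite addr0.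
rewrite ler_pM2r ?normr_gt0// ler_pdivlMr// ger_pMr//.
by rewrite lern1.
Qed.

(** The open mapping theorem applied to the operator [A v w = B v w] from [F]
    to its dual.  The norm of [A v] is replaced in the conclusion by an
    arbitrary bound [b] of the functional [B v]. *)
Lemma nondegenerate_lower_bound (F : completeNormedModType R) (B : F -> F -> R)
    (K : R) : Defs.nondegenerate B ->
    (forall v w, `|B v w| <= K * `|v| * `|w|) ->
  exists2 c : R, 0 < c & forall v (b : R),
    0 <= b -> (forall w, `|B v w| <= b * `|w|) -> c * `|v| <= b.
Proof.
move=> [A [AB bijA]] BK.
pose dual : completeNormedModType R := HB.pack (bounded_op F R^o)
  (Uniform_isComplete.Build (bounded_op F R^o) (@bounded_op_complete R F R^o)).
pose A' : {linear F -> dual} := A.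
have A_le v (b : R) : 0 <= b -> (forall w, `|B v w| <= b * `|w|) -> `|A v| <= b.
  by move=> b0 Bv; apply: op_norm_le => // w; rewrite AB.
have cA : continuous A'.
  have bA v : `|A v| <= `|K| * `|v|.
    apply: A_le => [|w]; first by rewrite mulr_ge0.
    apply: le_trans (BK v w) _.
    by rewrite ler_wpM2r// ler_wpM2r// ler_norm.
  exact: (@bounded_op_continuous _ _ _ (op_of_bound (@linearP _ _ _ _ A) bA)).
have [A'' A''K AK] := bijA.
have [|L L0 AL] := open_mapping cA.
  by move=> y; exists (A'' y); exact: AK.
have L1 : 0 < L + 1 by rewrite ltr_wpDl.
exists (L + 1)^-1 => [|v b b0 Bv]; first by rewrite invr_gt0.
rewrite ler_pdivrMl//; have [x Ax] := AL (A v).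
rewrite (bij_inj bijA Ax) => /le_trans; apply.
apply: le_trans (ler_wpM2l L0 (A_le v b b0 Bv)) _.
by rewrite ler_wpM2r// lerDl.
Qed.

End isolation.

(** * Partial derivatives of twice differentiable functions *)

Section slices.
Context {R : realType} {n : nat} {E : 'I_n -> completeNormedModType R}.
Local Notation normedE := (fun i => E i : normedModType R).
Local Notation prodE := (normed_prod normedE).
Local Notation restriction W i := (precomp W (@inclusion _ _ normedE i)).

Lemma partialE (W : normedModType R) i (g : prodE -> W) x :
  differentiable g x -> partial i g x = restriction W i (frechet g x).
Proof.
move=> dg.
have := @has_frechet_slice _ _ normedE W g x i (x i) (frechet g x).
rewrite dfwith_id => /(_ (differentiable_has_frechet dg))/has_frechetP[_ gE].
exact: gE.
Qed.

Lemma C2_near (U : set prodE) (g : prodE -> R^o) x :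
    open U -> Ck 2 U g -> U x ->
  (\forall y \near x, differentiable g y) /\ differentiable (frechet g) x.
Proof.
move=> openU [dg [d2g _]] Ux; split; last by apply: d2g; exact: mem_set.
have : \forall y \near x, U y by apply: open_nbhs_nbhs; split.
by apply: filterS => y Uy; apply: dg; exact: mem_set.
Qed.

(** Near [x i], the derivative of the slice at [y] is the restriction to the
    [i]-th factor of the derivative of [g] at [dfwith x i y]: a bounded linear
    operator applied to a slice of the differentiable map [frechet g]. *)
Lemma C2_slice (U : set prodE) (g : prodE -> R^o) x i :
    open U -> Ck 2 U g -> U x ->
  (\forall y \near x i, differentiable (fun z => g (dfwith x i z)) y) /\
  differentiable (frechet (fun z => g (dfwith x i z))) (x i).
Proof.
move=> openU gU Ux; have [dg d2g] := C2_near openU gU Ux.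
have near_slice : \forall y \near x i, differentiable g (dfwith x i y : prodE).
  have := @dfwith_cvg _ _ normedE x i (x i).
  by rewrite dfwith_id => /(_ _ dg).
have slice y : differentiable g (dfwith x i y : prodE) ->
    has_frechet (fun z => g (dfwith x i z)) y
      (restriction R^o i (frechet g (dfwith x i y : prodE))).
  by move=> dgy; apply: has_frechet_slice; exact: differentiable_has_frechet.
split; first by apply: filterS near_slice => y /slice/has_frechetP[].
have eqn : \forall y \near x i, frechet (fun z => g (dfwith x i z)) y =
    restriction R^o i (frechet g (dfwith x i y : prodE)).
  by apply: filterS near_slice => y /slice/has_frechetP[].
apply: (has_frechetP (has_frechet_near eqn _)).1.
apply: has_frechet_op_comp; apply: has_frechet_slice.
by rewrite dfwith_id; apply: differentiable_has_frechet.
Qed.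

End slices.

(** * The game *)

Section game.
Context {R : realType} {n : nat} {E : 'I_n -> completeNormedModType R}.
Context {M : forall i, banach_manifold (E i)}.

Local Notation prodM := (prod_topology (fun i => carrier (M i))).
Local Notation normedE := (fun i => E i : normedModType R).
Local Notation prodE := (normed_prod normedE).
Local Notation restriction i := (precomp R^o (@inclusion _ _ normedE i)).
Implicit Types (phi : product_chart M) (u : prodM) (f : 'I_n -> prodM -> R).

Lemma product_chart_cod_open phi : open (product_chart_cod phi).
Proof.
apply: (@box_open _ _ normedE (fun i => chart_cod (phi i))) => i.
exact: chart_cod_open.
Qed.

Lemma product_chart_cod_fun phi u :
  (forall i, chart_dom (phi i) (u i)) ->
  product_chart_cod phi (product_chart_fun phi u).
Proof. by move=> ud i; exists (u i). Qed.

(** This turns the slices of the cost functions in a chart into unilateral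
    deviations.  For [y] outside the image of the chart both sides are
    evaluated at the same default point. *)
Lemma in_chart_deviation phi (g : prodM -> R) u i y :
  (forall j, chart_dom (phi j) (u j)) ->
  in_chart phi g (dfwith (product_chart_fun phi u) i y) =
  g (dfwith u i (chart_inv (phi i) y)).
Proof.
move=> ud; rewrite /in_chart; congr (g _).
apply: functional_extensionality_dep => j.
have [<-|ij] := eqVneq i j; first by rewrite !dfwithin.
by rewrite !dfwithout// /product_chart_fun chart_funK//; exact: mem_set.
Qed.

(** Near [x] the game form is the tuple of the restrictions to the factors of
    the derivatives of the cost functions, a bounded linear image of finitely
    many differentiable maps. *)
Lemma differentiable_game_form phi f x :
    (forall i, C2 (f i)) -> is_product_chart phi -> product_chart_cod phi x ->
  differentiable (game_form phi f) x.
Proof.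
move=> fC2 phiM xcod.
have dg i := C2_near (@product_chart_cod_open phi) (fC2 i _ phiM) xcod.
have near_eq : \forall y \near x, game_form phi f y =
    (fun i => restriction i (frechet (in_chart phi (f i)) y)).
  have : \forall y \near x, forall i, differentiable (in_chart phi (f i)) y.
    apply: (@filter_forall _ _ (fun i (y : prodE) =>
      differentiable (in_chart phi (f i)) y) (nbhs x)) => i.
    exact: (dg i).1.
  apply: filterS => y dgy; apply: functional_extensionality_dep => i.
  exact: partialE.
pose L i := op_comp (restriction i) (frechet (frechet (in_chart phi (f i))) x).
apply: (has_frechetP (L := op_tuple L) _).1.
apply: has_frechet_near near_eq _.
apply: has_frechet_tuple => i; apply: has_frechet_op_comp.
exact: differentiable_has_frechet (dg i).2.
Qed.

(** The first-order necessary condition for the minimum of each player's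
    slice.  It is applied both to the equilibrium under study and to its
    possible neighbours. *)
Lemma local_nash_game_form0 phi f u :
    (forall i, C2 (f i)) -> product_chart_at phi u -> local_nash f u ->
  game_form phi f (product_chart_fun phi u) = 0.
Proof.
move=> fC2 [phiM ud] [W [Wu Wf]].
apply: functional_extensionality_dep => i.
have xcod := product_chart_cod_fun ud.
have [dh _] := C2_slice i (@product_chart_cod_open phi) (fC2 i _ phiM) xcod.
apply: local_min_frechet0.
  by apply: differentiable_has_frechet; exact: nbhs_singleton dh.
have inv_u : chart_inv (phi i) (phi i (u i)) = u i.
  by rewrite chart_funK//; exact: mem_set.
have near_W : \forall y \near phi i (u i), W i (chart_inv (phi i) y).
  apply: (@chart_inv_continuous _ _ _ (phi i)).
    by apply: mem_set; exists (u i).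
  by rewrite inv_u; have [oW Wui] := Wu i; exact: open_nbhs_nbhs.
apply: filterS near_W => y Wy.
rewrite !in_chart_deviation// inv_u dfwith_id.
have [->|yu] := pselect (chart_inv (phi i) y = u i).
  by rewrite dfwith_id.
exact: Wf.
Qed.

(** The second-order sufficient condition for the minimum of each player's
    slice, transported from the chart to the manifold. *)
Lemma differential_nash_strict f u :
  (forall i, C2 (f i)) -> differential_nash f u -> strict_local_nash f u.
Proof.
move=> fC2 [phi [[phiM ud] w0 pd]].
have xcod := product_chart_cod_fun ud.
have near_min i : \forall v \near u i, v <> u i -> f i u < f i (dfwith u i v).
  set x := product_chart_fun phi u in w0 pd xcod.
  pose h (y : E i) : R^o := in_chart phi (f i) (dfwith x i y).
  have [dh d2h] : (\forall y \near x i, differentiable h y) /\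
      differentiable (frechet h) (x i).
    exact: (C2_slice i (@product_chart_cod_open phi) (fC2 i _ phiM) xcod).
  have h0 : frechet h (x i) = 0 by have := congr1 (fun w => w i) w0.
  have [a a0 Ha] := pd i.
  (* Varying coordinate [i] twice varies it once, so the Hessian is the second
     derivative of the slice [h]. *)
  have partial_h :
      (fun y => partial i (in_chart phi (f i)) (dfwith x i y)) = frechet h.
    apply/funext => y; rewrite /partial dfwithin; congr (frechet _ _).
    by apply/funext => z; rewrite dfwith_dfwith.
  have {}Ha v : a * `|v| ^+ 2 <= frechet (frechet h) (x i) v v.
    by rewrite -partial_h; exact: Ha.
  have hmin :=
    second_order_strict_min dh h0 (differentiable_has_frechet d2h) a0 Ha.
  have dom_u : \forall v \near u i, chart_dom (phi i) v.
    by apply: open_nbhs_nbhs; split; [exact: chart_dom_open|exact: ud].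
  have := @chart_fun_continuous _ _ _ (phi i) (u i) (mem_set (ud i)) _ hmin.
  move=> /(filterI dom_u); apply: filterS => v [/= domv hv] vu.
  have phiv : phi i v <> x i.
    move=> e; apply: vu; rewrite -(chart_funK (mem_set domv)) e.
    by apply: chart_funK; exact: mem_set.
  have := hv phiv; rewrite /h !in_chart_deviation//.
  rewrite chart_funK; last exact: mem_set.
  by rewrite chart_funK ?dfwith_id//; exact: mem_set.
exists (fun i => (fun v => v <> u i -> f i u < f i (dfwith u i v))°).
split=> [i|i v /interior_subset]; last exact.
by split; [exact: open_interior|exact: near_min].
Qed.

Lemma strict_local_nash_local f u : strict_local_nash f u -> local_nash f u.
Proof.
by move=> [W [Wu Wf]]; exists W; split=> // i v Wv vu; rewrite ltW ?Wf.
Qed.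

(** Pairing with a vector of the product is a sum of [n] terms, so the
    functional [d_game_form phi f x v] has norm at most [n] times that of [D v],
    and a lower bound for the former gives one for the latter. *)
Lemma d_game_form_lower_bound phi f x :
  Defs.nondegenerate (d_game_form phi f x) ->
  exists2 c : R, 0 < c & forall v, c * `|v| <= `|frechet (game_form phi f) x v|.
Proof.
set D := frechet _ x => nd.
pose F : completeNormedModType R := HB.pack prodE
  (Uniform_isComplete.Build prodE (@normed_prod_complete R n E)).
have Bw v w : `|d_game_form phi f x v w| <= (n%:R * `|D v|) * `|w|.
  apply: le_trans (ler_norm_sum _ _ _) _.
  rewrite -mulrA -[X in X%:R](card_ord n) mulr_natl -sumr_const.
  apply: ler_sum => i _.
  apply: le_trans (op_norm_bound _ _) _; apply: ler_pM => //.
    exact: (@normed_prod_coord_le _ _ (fun i => bounded_op (E i) R^o)).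
  exact: (@normed_prod_coord_le _ _ normedE).
have [|c c0 cD] :=
  @nondegenerate_lower_bound R F (d_game_form phi f x) (n%:R * `|D|) nd.
  move=> v w; apply: le_trans (Bw v w) _.
  rewrite ler_wpM2r// -mulrA ler_wpM2l//.
  exact: op_norm_bound.
(* Dividing by [n + 1] rather than [n] covers the game without players. *)
have n1 : 0 < (n%:R + 1 : R) by rewrite ltr_wpDl.
exists (c / (n%:R + 1)) => [|v]; first exact: divr_gt0.
rewrite mulrAC ler_pdivrMr// [leRHS]mulrC.
apply: le_trans (cD v (n%:R * `|D v|) _ (Bw v)) _; first by rewrite mulr_ge0.
by rewrite ler_wpM2r// lerDl.
Qed.

(** Every local Nash equilibrium near [u] is a zero of the game form, of which
    [u] is an isolated zero; charts are injective, so the equilibrium is [u]. *)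
Lemma nondegenerate_isolated f u : (forall i, C2 (f i)) ->
    nondegenerate_d_game_form f u -> local_nash f u ->
  isolated_local_nash f u.
Proof.
move=> fC2 [phi phiu nd] uN; split=> //.
have [c c0 cD] := d_game_form_lower_bound nd.
have [phiM ud] := phiu.
have dG := differentiable_game_form fC2 phiM (product_chart_cod_fun ud).
have /nbhs_normP[e /= e0 isol] :=
  isolated_zero (differentiable_has_frechet dG) c0 cD
    (local_nash_game_form0 fC2 phiu uN).
exists [set v | forall i, chart_dom (phi i) (v i) /\
    `|phi i (u i) - phi i (v i)| < e].
  apply: (@filter_forall _ _ (fun i (v : prodM) => chart_dom (phi i) (v i) /\
    `|phi i (u i) - phi i (v i)| < e) (nbhs u)) => i.
  have : \forall y \near u i,
      chart_dom (phi i) y /\ `|phi i (u i) - phi i y| < e.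
    apply: filterI.
      by apply: open_nbhs_nbhs; split; [exact: chart_dom_open|exact: ud].
    have cphi := @chart_fun_continuous _ _ _ (phi i) (u i) (mem_set (ud i)).
    exact: cvgr_dist_lt cphi _ e0.
  exact: (@proj_continuous _ (fun i => carrier (M i)) i u).
move=> v vV vN.
have vd i := (vV i).1.
have vu : product_chart_fun phi v = product_chart_fun phi u.
  apply: isol; last exact: local_nash_game_form0 fC2 (conj phiM vd) vN.
  by apply: normed_prod_norm_lt => // i; exact: (vV i).2.
apply: functional_extensionality_dep => i.
have := congr1 (fun x : prodE => chart_inv (phi i) (x i)) vu.
by rewrite /product_chart_fun !chart_funK//; exact: mem_set.
Qed.

End game.

Theorem theorem2 (R : realType) (n : nat)
    (E : 'I_n -> completeNormedModType R)
    (M : forall i, banach_manifold (E i))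
    (f : 'I_n -> prod_topology (fun i => carrier (M i)) -> R)
    (f_C2 : forall i, C2 (f i))
    (u : prod_topology (fun i => carrier (M i))) :
  differential_nash f u ->
  nondegenerate_d_game_form f u ->
  strict_local_nash f u /\ isolated_local_nash f u.
Proof.
move=> uD nd; have uS := differential_nash_strict f_C2 uD.
by split=> //; apply: nondegenerate_isolated nd (strict_local_nash_local uS).
Qed.
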